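(* Let $w,v\in I_{d,n}$ with $w\ge v$. For every degree $m$, the standard monomials on $X_w^v$ of degree $m$ form a $K$-basis of the degree-$m$ component of the homogeneous coordinate ring $R_w^v$ of the Richardson variety $X_w^v$.
   Context: $K$ is an algebraically closed field of arbitrary characteristic, $1\le d<n$, and $G_{d,n}$ is the Grassmannian of $d$-dimensional subspaces of $K^n$, embedded in $\mathbb{P}(\wedge^d K^n)$ by the Plücker embedding. $I_{d,n}=\{(i_1,\dots,i_d)\in\mathbb{N}^d: 1\le i_1<\dots<i_d\le n\}$, partially ordered by $\underline i\ge\underline j\iff i_t\ge j_t$ for all $t$. For $\underline i\in I_{d,n}$, $p_{\underline i}$ is the Plücker coordinate (if $U$ is the column span of an $n\times d$ matrix $A$, $p_{\underline i}(U)$ is the minor of $A$ on rows $i_1,\dots,i_d$). With $V_t=\langle e_1,\dots,e_t\rangle$ and $V^t=\langle e_n,\dots,e_{n-t+1}\rangle$, the Schubert variety is $X_{\underline i}=\{U: \dim(U\cap V_{i_t})\ge t,\ 1\le t\le d\}$ and the opposite Schubert variety is $X^{\underline i}=\{U:\dim(U\cap V^{n-i_{(d-t+1)}+1})\ge t,\ 1\le t\le d\}$. The Richardson variety is $X_w^v=X_w\cap X^v$; it is nonempty iff $w\ge v$, and then it is a reduced irreducible closed subvariety of $G_{d,n}$. $R_w^v$ is the homogeneous coordinate ring of $X_w^v$ for the Plücker embedding. A monomial $p_{\tau_1}\cdots p_{\tau_m}$ (with $\tau_i\in I_{d,n}$) is standard if $\tau_1\ge\cdots\ge\tau_m$; it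 is standard on $X_w^v$ if moreover $w\ge\tau_1$ and $\tau_m\ge v$. *)

(* Defs.v *)
(* boolp provides the classical boolean reflection [< P >], needed to view an
   ideal as a boolean predicate. *)
From HB Require Import structures.
From mathcomp Require Import all_boot all_order all_algebra.
From mathcomp Require Import generic_quotient ring_quotient.
From mathcomp Require Import boolp.
From mathcomp Require Import mpoly.

Set Implicit Arguments.
Unset Strict Implicit.
Unset Printing Implicit Defensive.

Import GRing.Theory.
Local Open Scope ring_scope.
Local Open Scope quotient_scope.

(* Everything is indexed from 0: the entry i_t of the usual notation, with
   1 <= t <= d and 1 <= i_t <= n, is (tnth i t').+1 where t = t'.+1. *)
Record Idn (d n : nat) := MkIdn {
  Idn_tuple :> d.-tuple 'I_n;
  Idn_sorted : sorted ltn (map val Idn_tuple) }.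

HB.instance Definition _ (d n : nat) := [isSub for @Idn_tuple d n].
HB.instance Definition _ (d n : nat) := [Finite of Idn d n by <:].

Definition Ige (d n : nat) : rel (Idn d n) :=
  fun i j => [forall t : 'I_d, tnth j t <= tnth i t]%N.

Section Varieties.
Variables (K : fieldType) (d n : nat).

Definition basis_vec (j : 'I_n) : 'cV[K]_n := delta_mx j 0.

(* <e_1, ..., e_s> and <e_n, ..., e_{n-s+1}>, for s <= n. *)
Definition Vlow (s : nat) : {vspace 'cV[K]_n} :=
  <<[seq basis_vec j | j : 'I_n <- enum 'I_n & (j < s)%N]>>%VS.
Definition Vup (s : nat) : {vspace 'cV[K]_n} :=
  <<[seq basis_vec j | j : 'I_n <- enum 'I_n & (n - s <= j)%N]>>%VS.

Definition Grassmannian (U : {vspace 'cV[K]_n}) : Prop := \dim U = d.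

Definition Schubert (i : Idn d n) (U : {vspace 'cV[K]_n}) : Prop :=
  Grassmannian U /\
  forall t : 'I_d, (t.+1 <= \dim (U :&: Vlow (tnth i t).+1))%N.

(* In 1-based notation, (tnth i (rev_ord t)).+1 is the entry i_{d-t+1}. *)
Definition opp_Schubert (i : Idn d n) (U : {vspace 'cV[K]_n}) : Prop :=
  Grassmannian U /\
  forall t : 'I_d,
    (t.+1 <= \dim (U :&: Vup (n - (tnth i (rev_ord t)).+1 + 1)))%N.

Definition Richardson (w v : Idn d n) (U : {vspace 'cV[K]_n}) : Prop :=
  Schubert w U /\ opp_Schubert v U.

Definition colspan (A : 'M[K]_(n, d)) : {vspace 'cV[K]_n} :=
  <<[seq col j A | j <- enum 'I_d]>>%VS.

Definition plucker (A : 'M[K]_(n, d)) (i : Idn d n) : K :=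
  \det (rowsub (tnth i) A).

(* The homogeneous coordinate ring of P(/\^d K^n): one variable for each
   element of I_{d,n}, numbered by enum_rank. *)
Definition Pring := {mpoly K[#|{: Idn d n}|]}.

HB.instance Definition _ := GRing.ComAlgebra.on Pring.


Definition pvar (i : Idn d n) : Pring := 'X_(enum_rank i).

Definition peval (x : Idn d n -> K) (f : Pring) : K :=
  f.@[fun k => x (enum_val k)].

End Varieties.

Section CoordinateRing.
Variables (K : fieldType) (d n : nat) (X : {vspace 'cV[K]_n} -> Prop).

Local Notation S := (Pring K d n).

(* The affine cone over the image of X under the Pluecker embedding.  Letting A
   run over all matrices with column span U gives, as 0 < d, every
   representative of the projective point attached to U.  The origin always
   belongs to the cone, so that the ideal below is proper even for empty X. *)
Definition affine_cone (x : Idn d n -> K) : Prop :=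
  (forall i, x i = 0) \/
  (exists2 A : 'M[K]_(n, d), X (colspan A) & forall i, x i = plucker A i).

Definition homog_vanishing (h : S) : Prop :=
  h \is homog mdeg /\ forall x, affine_cone x -> peval x h = 0.

(* The ideal generated by the homogeneous polynomials vanishing on X. *)
Definition in_vanishing_ideal (f : S) : Prop :=
  exists2 s : seq (S * S),
    (forall gh, gh \in s -> homog_vanishing gh.2) &
    f = \sum_(gh <- s) gh.1 * gh.2.

Definition vanishing_ideal : S -> bool := fun f => `[< in_vanishing_ideal f >].

Fact vanishing_ideal_closed : idealr_closed vanishing_ideal.
Proof.
split=> [||a f g].
- by apply/asboolP; exists [::]; rewrite ?big_nil.
- apply/asboolP => -[s sP /(congr1 (peval (fun _ => 0)))].
  rewrite /peval rmorph1 rmorph_sum big_seq big1 => [/eqP|gh /sP [_ gh0]].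
    by rewrite oner_eq0.
  rewrite rmorphM /=; have := gh0 (fun _ => 0); rewrite /peval => ->.
    by rewrite mulr0.
  by left.
- move=> /asboolP[s sP ->] /asboolP[r rP ->]; apply/asboolP.
  exists ([seq (a * gh.1, gh.2) | gh <- s] ++ r).
    by move=> gh; rewrite mem_cat => /orP[/mapP[p /sP ph ->]|/rP].
  rewrite big_cat big_map /= mulr_sumr; congr (_ + _).
  by apply: eq_bigr => p _; rewrite mulrA.
Qed.

HB.instance Definition _ :=
  isIdealr.Build S vanishing_ideal vanishing_ideal_closed.

Definition coord_ring := {ideal_quot (vanishing_ideal : idealr S)}.

HB.instance Definition _ := GRing.ComNzRing.on coord_ring.

Definition to_coord_ring (f : S) : coord_ring := \pi_(coord_ring) f.

Fact to_coord_ring_zmod_morphism : zmod_morphism to_coord_ring.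
Proof. by move=> f g; rewrite /to_coord_ring rmorphB. Qed.
Fact to_coord_ring_monoid_morphism : monoid_morphism to_coord_ring.
Proof.
by split=> [|f g]; rewrite /to_coord_ring ?rmorph1 ?rmorphM.
Qed.
HB.instance Definition _ := GRing.isZmodMorphism.Build S coord_ring
  to_coord_ring to_coord_ring_zmod_morphism.
HB.instance Definition _ := GRing.isMonoidMorphism.Build S coord_ring
  to_coord_ring to_coord_ring_monoid_morphism.

Definition coord_scale (c : K) (x : coord_ring) : coord_ring :=
  to_coord_ring c%:A * x.

Fact coord_scaleA a b x :
  coord_scale a (coord_scale b x) = coord_scale (a * b) x.
Proof. by rewrite /coord_scale mulrA -rmorphM -scalerAl mul1r scalerA. Qed.
Fact coord_scale1 : left_id 1 coord_scale.
Proof. by move=> x; rewrite /coord_scale scale1r rmorph1 mul1r. Qed.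
Fact coord_scaleDr : right_distributive coord_scale +%R.
Proof. by move=> a x y; rewrite /coord_scale mulrDr. Qed.
Fact coord_scaleDl x : {morph coord_scale^~ x : a b / a + b}.
Proof. by move=> a b; rewrite /coord_scale scalerDl rmorphD mulrDl. Qed.
HB.instance Definition _ := GRing.Zmodule_isLmodule.Build K coord_ring
  coord_scaleA coord_scale1 coord_scaleDr coord_scaleDl.

Fact coord_scaleAl (a : K) (x y : coord_ring) : a *: (x * y) = a *: x * y.
Proof. exact: mulrA. Qed.
HB.instance Definition _ :=
  GRing.Lmodule_isLalgebra.Build K coord_ring coord_scaleAl.
HB.instance Definition _ := GRing.Lalgebra_isComAlgebra.Build K coord_ring.

Fact to_coord_ring_scalable : scalable to_coord_ring.
Proof.
by move=> a f; rewrite -[a *: f]mulr_algl rmorphM.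
Qed.
HB.instance Definition _ := GRing.isScalable.Build K S coord_ring *:%R
  to_coord_ring to_coord_ring_scalable.

Definition coord_ring_deg (m : nat) (x : coord_ring) : Prop :=
  exists2 f : S, f \is m.-homog & x = to_coord_ring f.

Definition pmonomial (m : nat) (t : m.-tuple (Idn d n)) : coord_ring :=
  \prod_(tau <- t) to_coord_ring (pvar K tau).

End CoordinateRing.

Section StandardMonomials.
Variables (d n : nat).

Definition standard (m : nat) (t : m.-tuple (Idn d n)) : bool :=
  sorted (@Ige d n) t.

(* For m = 0 the last two conditions are vacuous (by reflexivity of Ige). *)
Definition standard_on (w v : Idn d n) (m : nat) (t : m.-tuple (Idn d n)) :
    bool :=
  [&& standard t, Ige w (head w t) & Ige (last v t) v].

End StandardMonomials.

(* The family b is a K-basis of the subspace P of V. *)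
Definition is_basis (K : fieldType) (V : lmodType K) (P : V -> Prop)
    (I : finType) (b : I -> V) : Prop :=
  [/\ forall i, P (b i),
      forall x, P x -> exists c : I -> K, x = \sum_i c i *: b i
    & forall c : I -> K, \sum_i c i *: b i = 0 -> forall i, c i = 0].

(* Main.v *)
Require Import Defs.
From mathcomp Require Import all_boot all_order all_algebra.
From mathcomp Require Import all_fingroup.
From mathcomp Require Import generic_quotient ring_quotient.
From mathcomp Require Import boolp mpoly zify.

(* Spanning: the quadratic Pluecker relations rewrite a product p_x p_y with
   x not >= y as a combination of products p_x' p_y' in which x' has a larger
   sum of entries and x' and y' together have the same one; iterating
   terminates at standard monomials.  A coordinate p_x that does not vanish at
   a point of the Richardson variety satisfies w >= x >= v, so the standard
   monomials that are not standard on it vanish there.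
   Independence: every matrix of rank d whose column t is supported on the rows
   v_t, ..., w_t spans a point of the Richardson variety.  Taking suitable
   powers of one variable X as its entries makes the diagonal term of each
   minor with w >= x >= v the unique one of highest degree, and gives different
   degrees to different standard monomials. *)

Set Implicit Arguments.
Unset Strict Implicit.
Unset Printing Implicit Defensive.

Import GRing.Theory.
Local Open Scope ring_scope.
Local Open Scope quotient_scope.

(** * Quadratic relations between minors *)

Lemma det_sum_rows (R : comNzRingType) k (I : finType) (N : I -> 'M[R]_k) :
  \det (\sum_b N b) =
  \sum_(f : {ffun 'I_k -> I}) \det (\matrix_(i, j) N (f i) i j).
Proof.
rewrite /determinant exchange_big; apply: eq_bigr => s _ /=.
under eq_bigr do rewrite summxE.
rewrite bigA_distr_bigA mulr_sumr; apply: eq_bigr => f _.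
by congr (_ * _); apply: eq_bigr => i _; rewrite mxE.
Qed.

(** The rows indexed by [B] lie in the span of the [d] rows of [C]. Were [M] invertible, the
    identity of size [#|B|] would factor through dimension [d]. *)
Lemma det0_rows_factor (F : fieldType) N d (M : 'M[F]_N) (B : {pred 'I_N})
    (u : 'I_N -> 'rV[F]_d) (C : 'M[F]_(d, N)) :
  (forall i, i \in B -> row i M = u i *m C) -> (d < #|B|)%N -> \det M = 0.
Proof.
move=> rowM; apply: contraTeq; rewrite -unitfE -[_ \in _]/(M \in unitmx) => uM.
rewrite -leqNgt.
pose E : 'M[F]_(#|B|, N) := rowsub enum_val 1%:M.
pose U : 'M[F]_(#|B|, d) := \matrix_i u (enum_val i).
have EM : E *m M = U *m C.
  apply/row_matrixP=> i; rewrite !row_mul rowK -(rowM _ (enum_valP i)).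
  by rewrite row_rowsub rowE -rowE row1 -rowE.
apply: (@mulmx1_min _ _ _ U (C *m invmx M *m E^T)).
rewrite !mulmxA -EM mulmxK //; apply/matrixP => i j; rewrite !mxE.
rewrite (bigD1 (enum_val i)) //= big1 => [|k ki]; rewrite !mxE.
  by rewrite eqxx mul1r addr0 (inj_eq enum_val_inj) eq_sym.
by rewrite eq_sym (negPf ki) mul0r.
Qed.

Lemma enum_perm_split k d (b : pred 'I_k) : #|b| = d ->
  exists s : 'S_k, forall i, b (s i) = (i < d)%N.
Proof.
move=> bd; pose t := enum b ++ enum (predC b).
have pt : perm_eq t (ord_tuple k).
  apply: uniq_perm; rewrite ?val_ord_tuple ?enum_uniq //.
    rewrite cat_uniq !enum_uniq andbT /=; apply/hasPn => x.
    by rewrite !mem_enum.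
  by move=> x; rewrite mem_cat !mem_enum /= orbN.
have st : size t == k by rewrite (perm_size pt) size_tuple.
have /tuple_permP [s ts] : perm_eq (Tuple st) (ord_tuple k) by [].
exists s => i.
have -> : s i = nth i t i.
  by rewrite (ts : t = _) -tnth_nth tnth_mktuple tnth_ord_tuple.
rewrite nth_cat -cardE bd; case: ltnP => id.
  by rewrite -[b _]/(_ \in b) -mem_enum mem_nth // -cardE bd.
apply: negbTE; rewrite -[~~ _]/(_ \in predC b) -mem_enum mem_nth //.
have := size_cat (enum b) (enum (predC b)); rewrite -/t (eqP st) -!cardE bd.
by have := ltn_ord i; lia.
Qed.

Section PluckerRelations.
Variables (K : fieldType) (d n : nat).
Implicit Types (A : 'M[K]_(n, d)) (h : 'I_(d + d) -> 'I_n).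

Definition entry_sum (x : Idn d n) : nat := (\sum_t tnth x t)%N.

Lemma Idn_ltn (x : Idn d n) (s t : 'I_d) :
  (s < t)%N -> (tnth x s < tnth x t)%N.
Proof.
move=> st; have := Idn_sorted x; rewrite (sorted_pairwise ltn_trans).
move=> /(pairwiseP 0%N) /(_ s t); rewrite !inE size_map size_tuple !ltn_ord.
by move=> /(_ isT isT st); rewrite !(nth_map (tnth x s)) ?size_tuple // -!tnth_nth.
Qed.

(** A repeated row kills the minor; otherwise sorting the rows costs a sign [e] and keeps their
    sum. *)
Lemma det_rowsub_Idn (f : 'I_d -> 'I_n) :
  (forall A, \det (rowsub f A) = 0) \/
  exists (e : K) (x : Idn d n), entry_sum x = (\sum_t f t)%N /\
    forall A, \det (rowsub f A) = e * plucker A x.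
Proof.
have [/injectiveP f_inj|/injectivePn [i [j ij fij]]] := boolP (injectiveb f);
  last first.
  left=> A; apply: (determinant_alternate ij) => k; by rewrite !mxE fij.
right; pose l := [tuple f i | i < d].
pose r : rel 'I_n := fun a b => (a <= b)%N.
have sl : size (sort r l) == d by rewrite size_sort size_tuple.
have sorted_l : sorted ltn (map val (Tuple sl)).
  rewrite ltn_sorted_uniq_leq (map_inj_uniq val_inj) sort_uniq.
  rewrite map_inj_uniq ?enum_uniq //= sorted_map.
  by apply: sort_sorted => a b; apply: leq_total.
pose x := MkIdn sorted_l.
have /tuple_permP [p lp] : perm_eq l (Tuple sl) by rewrite perm_sym perm_sort.
have fp i : f i = tnth x (p i).
  by rewrite -(tnth_mktuple f i) -/l -[RHS](tnth_mktuple (fun i => tnth x (p i)) i);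
     congr tnth; apply: val_inj.
exists ((-1) ^+ p), x; split.
  rewrite /entry_sum (reindex_inj (@perm_inj _ p)) /=.
  by apply: eq_bigr => i _; rewrite fp.
move=> A; have -> : rowsub f A = row_perm p (rowsub (tnth x) A).
  by apply/matrixP => i j; rewrite !mxE fp.
by rewrite row_permE det_mulmx det_perm.
Qed.

(** Each listed row of [A] is put in the left or the right block of [d] columns, so that the
    determinant is zero or, up to sign, a product of two minors of [A]. *)
Definition half_mx A h (b : 'I_(d + d) -> bool) : 'M[K]_(d + d) :=
  \matrix_i (if b i then row_mx (row (h i) A) 0 else row_mx 0 (row (h i) A)).

Lemma det_half_mx_perm A h b (s : 'S_(d + d)) :
  (forall i, b (s i) = (i < d)%N) ->
  \det (half_mx A h b) = (-1) ^+ s *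
    (\det (rowsub (h \o s \o @lshift d d) A) *
     \det (rowsub (h \o s \o @rshift d d) A)).
Proof.
move=> bs; apply: (canRL (signrMK _)); rewrite -det_perm -det_mulmx -row_permE.
rewrite -(det_ublock _ 0); congr (\det _); apply/matrixP => i j.
rewrite mxE mxE bs; case: (split_ordP i) => k ->.
  by rewrite block_mxEv col_mxEu !mxE; case: (splitP j) => l _; rewrite !mxE.
by rewrite block_mxEv col_mxEd !mxE; case: (splitP j) => l _; rewrite !mxE.
Qed.

(** One half receives more than [d] rows, all in a space of dimension [d]. *)
Lemma det_half_mx0 A h b : #|b| != d -> \det (half_mx A h b) = 0.
Proof.
rewrite neq_ltn => /orP [bd|bd].
  apply: (@det0_rows_factor _ _ d _ (predC b) (fun i => row (h i) A)
            (row_mx 0 1%:M)) => [i|].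
    by rewrite inE rowK => /negPf ->; rewrite mul_mx_row mulmx0 mulmx1.
  by rewrite -(ltn_add2l #|b|) cardC card_ord ltn_add2r.
apply: (@det0_rows_factor _ _ d _ b (fun i => row (h i) A) (row_mx 1%:M 0)) => //.
by move=> i; rewrite rowK unfold_in => ->; rewrite mul_mx_row mulmx0 mulmx1.
Qed.

Section Exchange.
Variables (x y : Idn d n) (r : 'I_d).
Hypothesis xy_r : (tnth x r < tnth y r)%N.

Let h (i : 'I_(d + d)) : 'I_n :=
  match split i with inl t => tnth x t | inr t => tnth y t end.

Let allowed (b : bool) (i : 'I_(d + d)) : bool :=
  match split i with
  | inl t => b || (t <= r)%N
  | inr t => ~~ b || (r <= t)%N
  end.

Let f0 : {ffun 'I_(d + d) -> bool} := [ffun i : 'I_(d + d) => (i < d)%N].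

Let hl t : h (lshift d t) = tnth x t.
Proof. by rewrite /h -[lshift d t]/(unsplit (inl t)) unsplitK. Qed.
Let hr t : h (rshift d t) = tnth y t.
Proof. by rewrite /h -[rshift d t]/(unsplit (inr t)) unsplitK. Qed.
Let allowedl b t : allowed b (lshift d t) = b || (t <= r)%N.
Proof. by rewrite /allowed -[lshift d t]/(unsplit (inl t)) unsplitK. Qed.
Let allowedr b t : allowed b (rshift d t) = ~~ b || (r <= t)%N.
Proof. by rewrite /allowed -[rshift d t]/(unsplit (inr t)) unsplitK. Qed.

(* Rows 0..r of x and r..d-1 of y may go to either half.  In the matrix whose
   rows are the sums over the allowed halves these d+1 rows have the form (a, a)
   with a of length d, so they are dependent. *)
Lemma sum_det_half_mx0 A :
  \sum_(f : {ffun 'I_(d + d) -> bool} | [forall i, allowed (f i) i])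
     \det (half_mx A h f) = 0.
Proof.
pose N b : 'M[K]_(d + d) :=
  \matrix_i (if allowed b i then row i (half_mx A h (fun=> b)) else 0).
have rowN b i : row i (N b) =
    if allowed b i then row i (half_mx A h (fun=> b)) else 0 by apply: rowK.
have : \det (\sum_b N b) = 0.
  apply: (@det0_rows_factor _ _ d _
    [pred i | allowed true i && allowed false i]
    (fun i => row (h i) A) (row_mx 1%:M 1%:M)) => [i /andP [at_i af_i]|].
    rewrite big_bool linearD /= !rowN at_i af_i !rowK mul_mx_row mulmx1.
    by rewrite add_row_mx addr0 add0r.
  rewrite -sum1_card big_mkcond big_split_ord /= -big_split /=.
  under eq_bigr => t _ do rewrite !inE !allowedl !allowedr /= andbT.
  have -> : (d < \sum_(t < d) ((if t <= r then 1 else 0) +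
                              if r <= t then 1 else 0))%N =
            (d < \sum_(t < d) (1 + (t == r)))%N.
    congr (_ < _)%N; apply: eq_bigr => t _; rewrite -(inj_eq val_inj) /=.
    by case: ltngtP.
  by rewrite big_split /= sum1_card card_ord (bigD1 r) //= eqxx; lia.
rewrite det_sum_rows => sum0; rewrite -[RHS]sum0 big_mkcond /=.
apply: eq_bigr => f _; case: ifPn => [/forallP f_ok|/forallPn [i nok]].
  congr (\det _); apply/matrixP => i j.
  by rewrite mxE [RHS]mxE [in RHS]mxE f_ok !mxE.
rewrite (expand_det_row _ i) big1 // => j _.
by rewrite [X in X * _]mxE mxE (negPf nok) mxE mul0r.
Qed.

(** [k] rows of [x] leave the left half and, its size being [d], as many rows of [y] enter. Each
    leaving entry is at most x_r, each entering one at least y_r, and x_r < y_r; [f != f0] gives k >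
    0. *)
Lemma entry_sum_exchange (f : {ffun 'I_(d + d) -> bool}) :
  (forall i, allowed (f i) i) -> #|[pred i | f i]| = d -> f != f0 ->
  (entry_sum x < \sum_(i | f i) h i)%N.
Proof.
move=> f_ok fd f_neq.
have := fd; rewrite -sum1_card big_mkcond big_split_ord /=.
set a := (X in (X + _)%N = d); set b := (X in (_ + X)%N = d) => abd.
pose k := (\sum_(t < d) ~~ f (lshift d t))%N.
have ka : (a + k = d)%N.
  rewrite -big_split /= -[RHS]card_ord -sum1_card; apply: eq_bigr => t _.
  by rewrite unfold_in; case: (f _).
have kb : b = k by lia.
have k_gt0 : (0 < k)%N.
  rewrite lt0n; apply: contraNneq f_neq => k0; apply/eqP/ffunP => i.
  rewrite ffunE; case: (split_ordP i) => t -> /=.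
    move/eqP: k0; rewrite sum_nat_eq0 => /forallP /(_ t).
    by case: (f _).
  move: kb; rewrite k0 => /eqP; rewrite sum_nat_eq0 => /forallP /(_ t).
  by rewrite inE; case: (f _).
have up : (b * tnth y r <= \sum_(t < d) 
    if f (rshift d t) then h (rshift d t) : nat else 0)%N.
  rewrite /b big_distrl /=; apply: leq_sum => t _; rewrite inE.
  have := f_ok (rshift d t); rewrite allowedr hr; case: (f _) => //=.
  rewrite mul1n leq_eqVlt => /orP [/eqP/val_inj -> //|].
  by move=> /(Idn_ltn y)/ltnW.
have low : (\sum_(t < d) ~~ f (lshift d t) * tnth x t <= k * tnth x r)%N.
  rewrite /k big_distrl /=; apply: leq_sum => t _.
  have := f_ok (lshift d t); rewrite allowedl; case: (f _) => //=.
  rewrite !mul1n leq_eqVlt => /orP [/eqP/val_inj -> //|].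
  by move=> /(Idn_ltn x)/ltnW.
have split_x : (entry_sum x =
   \sum_(t < d) (if f (lshift d t) then h (lshift d t) : nat else 0) +
   \sum_(t < d) ~~ f (lshift d t) * tnth x t)%N.
  rewrite -big_split /=; apply: eq_bigr => t _.
  by rewrite hl; case: (f _); rewrite ?mul1n ?addn0.
rewrite split_x [leqRHS]big_mkcond [leqRHS]big_split_ord /= ltn_add2l.
apply: leq_ltn_trans low _; apply: leq_trans up.
by rewrite kb ltn_pmul2l.
Qed.

(** In the vanishing sum [f0] (rows of [x] left, rows of [y] right) contributes p_x p_y; the other
    terms move to the right-hand side. *)
Lemma plucker_exchange_at :
  exists c : {ffun 'I_(d + d) -> bool} -> K * Idn d n * Idn d n,
    (forall f, (c f).1.1 != 0 ->
       (entry_sum x < entry_sum (c f).1.2)%N /\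
       (entry_sum (c f).1.2 + entry_sum (c f).2 = entry_sum x + entry_sum y)%N) /\
    forall A, plucker A x * plucker A y =
      \sum_f (c f).1.1 * (plucker A (c f).1.2 * plucker A (c f).2).
Proof.
have term (f : {ffun 'I_(d + d) -> bool}) :
  exists c : K * Idn d n * Idn d n,
    (c.1.1 != 0 -> (entry_sum x < entry_sum c.1.2)%N /\
      (entry_sum c.1.2 + entry_sum c.2 = entry_sum x + entry_sum y)%N) /\
    forall A, (if [forall i, allowed (f i) i] && (f != f0)
               then - \det (half_mx A h f) else 0) =
      c.1.1 * (plucker A c.1.2 * plucker A c.2).
  have [/andP [/forallP f_ok f_neq]|_] :=
    boolP ([forall i, allowed (f i) i] && (f != f0)); last first.
    (* Terms that vanish get the coefficient 0 and the dummy pair [(x, y)], so the entry sums are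
       controlled only where the coefficient is nonzero. *)
    by exists (0, x, y); split=> [|A]; rewrite ?eqxx ?mul0r.
  have [fd|fd] := eqVneq #|[pred i | f i]| d; last first.
    exists (0, x, y); split=> [|A]; rewrite ?eqxx ?mul0r //.
    by rewrite det_half_mx0 ?oppr0.
  (* [s] brings the rows of the left half to the front, which makes the matrix block diagonal. *)
  have [s fs] := enum_perm_split (b := fun i => f i) fd.
  have detf A := det_half_mx_perm A h fs.
  have [z|[e1 [x1 [sx1 px1]]]] := det_rowsub_Idn (h \o s \o @lshift d d).
    exists (0, x, y); split=> [|A]; rewrite ?eqxx ?mul0r //.
    by rewrite detf z mul0r mulr0 oppr0.
  have [z|[e2 [x2 [sx2 px2]]]] := det_rowsub_Idn (h \o s \o @rshift d d).
    exists (0, x, y); split=> [|A]; rewrite ?eqxx ?mul0r //.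
    by rewrite detf z !mulr0 oppr0.
  exists (- ((-1) ^+ s * e1 * e2), x1, x2); split=> /= [_|A]; last first.
    by rewrite detf px1 px2 mulNr -!mulrA; congr (- (_ * (_ * _))); rewrite mulrCA.
  split.
    apply: leq_trans (entry_sum_exchange f_ok fd f_neq) _.
    rewrite sx1 (reindex_inj (@perm_inj _ s)) /=.
    rewrite big_mkcond big_split_ord /= -[leqRHS]addn0; apply/eq_leq.
    congr (_ + _)%N; first by apply: eq_bigr => t _; rewrite fs /= ltn_ord.
    by rewrite big1 // => t _; rewrite fs /= ltnNge leq_addr.
  transitivity (\sum_i (h i : nat))%N.
    by rewrite sx1 sx2 [RHS](reindex_inj (@perm_inj _ s)) [RHS]big_split_ord.
  by rewrite big_split_ord; congr (_ + _)%N; apply: eq_bigr => t _; rewrite ?hl ?hr.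
have [c cP] := fin_all_exists term.
exists c; split=> [f|A]; first by have [] := cP f.
have := sum_det_half_mx0 A; rewrite (bigD1 f0) /=; last first.
  apply/forallP => i; rewrite ffunE; case: (split_ordP i) => t -> /=.
    by rewrite allowedl.
  by rewrite allowedr.
have f0_1 i : f0 ((1%g : 'S_(d + d)) i) = (i < d)%N by rewrite perm1 ffunE.
rewrite (det_half_mx_perm A h f0_1) odd_perm1 mul1r => /(canRL (addrK _)).
rewrite add0r -sumrN big_mkcond.
under [X in _ = X -> _]eq_bigr => f _ do rewrite (cP f).2.
move=> <-; rewrite /plucker; congr (_ * _); congr (\det _); apply/matrixP => i j.
  by rewrite !mxE /= perm1 hl.
by rewrite !mxE /= perm1 hr.
Qed.

End Exchange.

End PluckerRelations.

(** * Straightening *)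

Section Straightening.
Variables (K : fieldType) (d n : nat).
Implicit Types (A : 'M[K]_(n, d)) (s : seq (Idn d n)).

Lemma plucker_exchange (x y : Idn d n) : ~~ Ige x y ->
  exists (I : finType) (c : I -> K * Idn d n * Idn d n),
    (forall i, (c i).1.1 != 0 ->
       (entry_sum x < entry_sum (c i).1.2)%N /\
       (entry_sum (c i).1.2 + entry_sum (c i).2 = entry_sum x + entry_sum y)%N) /\
    forall A, plucker A x * plucker A y =
      \sum_i (c i).1.1 * (plucker A (c i).1.2 * plucker A (c i).2).
Proof.
rewrite negb_forall => /existsP [r]; rewrite -ltnNge => xy_r.
by have [c cP] := plucker_exchange_at K xy_r; eexists; exists c.
Qed.

(** The termination measure: earlier factors have larger multipliers, so moving entry sum towards
    the front raises it. *)
Fixpoint weight s : nat :=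
  if s is x :: s' then (size s * entry_sum x + weight s')%N else 0%N.

(** Multipliers of adjacent factors differ by one, so the weight grows by exactly
    [entry_sum x' - entry_sum x]. *)
Lemma weight_exchange s1 s2 (x y x' y' : Idn d n) :
  (entry_sum x < entry_sum x')%N ->
  (entry_sum x' + entry_sum y' = entry_sum x + entry_sum y)%N ->
  (weight (s1 ++ x :: y :: s2) < weight (s1 ++ x' :: y' :: s2))%N.
Proof.
move=> lt_x eq_xy; elim: s1 => [|z s1 IH] /=; first by nia.
by rewrite !size_cat /= ltn_add2l.
Qed.

Lemma weight_bound s : (weight s <= size s * size s * (d * n))%N.
Proof.
elim: s => //= x s IH; have : (entry_sum x <= d * n)%N.
  rewrite /entry_sum -[X in (_ <= X * _)%N]card_ord -sum_nat_const.
  by apply: leq_sum => t _; apply: ltnW.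
nia.
Qed.

Lemma nonstandard_split s : ~~ sorted (@Ige d n) s ->
  exists s1 x y s2, s = s1 ++ x :: y :: s2 /\ ~~ Ige x y.
Proof.
elim: s => [|x [|y s] IH] //=; rewrite negb_and.
have [xy /= nst|] := boolP (Ige x y); last by exists [::], x, y, s.
have [s1 [a [b [s2 [-> nab]]]]] := IH nst.
by exists (x :: s1), a, b, s2.
Qed.

(** The coefficients do not depend on [A]: one identity for all matrices, without reference to a
    Richardson variety. *)
Definition std_span m (F : 'M[K]_(n, d) -> K) : Prop :=
  exists c : m.-tuple (Idn d n) -> K, forall A,
    F A = \sum_(t : m.-tuple (Idn d n) | standard t)
            c t * \prod_(x <- t) plucker A x.

Lemma std_span_sum m (I : finType) (c : I -> K) (F : I -> 'M[K]_(n, d) -> K) :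
  (forall i, c i != 0 -> std_span m (F i)) ->
  std_span m (fun A => \sum_i c i * F i A).
Proof.
move=> FP; have term i : exists e : m.-tuple (Idn d n) -> K, forall A,
    c i * F i A = \sum_(t : m.-tuple (Idn d n) | standard t)
                    e t * \prod_(x <- t) plucker A x.
  have [->|/FP [e eP]] := eqVneq (c i) 0.
    by exists (fun=> 0) => A; rewrite mul0r big1 // => t _; rewrite mul0r.
  exists (fun t => c i * e t) => A; rewrite eP mulr_sumr.
  by apply: eq_bigr => t _; rewrite mulrA.
have [e eP] := fin_all_exists term.
exists (fun t => \sum_i e i t) => A; under eq_bigr => i _ do rewrite eP.
by rewrite exchange_big; apply: eq_bigr => t _; rewrite mulr_suml.
Qed.

Lemma straightening m s : size s = m ->
  std_span m (fun A => \prod_(x <- s) plucker A x).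
Proof.
(* Every exchange raises the weight, which never exceeds this bound; the gap is the induction
   measure. *)
have [k] := ubnP (m * m * (d * n) - weight s)%N.
elim: k s => // k IH s s_lt sz.
have [st|/nonstandard_split [s1 [x [y [s2 [s_def nxy]]]]]] :=
  boolP (sorted (@Ige d n) s).
  pose t0 : m.-tuple (Idn d n) := tcast sz (in_tuple s).
  have t0E : t0 = s :> seq _ by rewrite val_tcast.
  exists (fun t => (t == t0)%:R) => A.
  rewrite (bigD1 t0) /=; last by rewrite /standard t0E.
  rewrite eqxx mul1r t0E [X in _ + X]big1 ?addr0 //.
  by move=> t /andP [_ /negPf ->]; rewrite mul0r.
have [I [c [cP cE]]] := plucker_exchange nxy.
pose s' i := s1 ++ (c i).1.2 :: (c i).2 :: s2.
have [|e eE] := @std_span_sum m I (fun i => (c i).1.1)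
    (fun i A => \prod_(x <- s' i) plucker A x).
  move=> i /cP [lt_x eq_xy]; apply: IH; last first.
    by rewrite -sz s_def !size_cat.
  have := weight_exchange s1 s2 lt_x eq_xy; rewrite -s_def -/(s' i).
  have := weight_bound (s' i).
  have -> : size (s' i) = m by rewrite -sz s_def !size_cat.
  lia.
exists e => A; rewrite -eE s_def big_cat !big_cons /=.
rewrite [X in _ * X]mulrA cE mulr_suml mulr_sumr.
by apply: eq_bigr => i _; rewrite big_cat !big_cons /= -!mulrA mulrCA.
Qed.
End Straightening.

(** * Minors on Schubert varieties *)

Lemma card_ord_ltn d k : (k <= d)%N -> #|[pred i : 'I_d | (i < k)%N]| = k.
Proof.
move=> kd; rewrite -sum1_card -[RHS]card_ord -sum1_card.
by rewrite (big_ord_widen _ (fun=> 1%N) kd).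
Qed.

Lemma card_ord_geq d k : (k <= d)%N -> #|[pred i : 'I_d | (k <= i)%N]| = (d - k)%N.
Proof.
move=> kd; apply: (@addnI k); rewrite subnKC // -[RHS]card_ord.
rewrite -(cardC [pred i : 'I_d | (i < k)%N]) card_ord_ltn //.
by congr (_ + _)%N; apply: eq_card => i; rewrite !inE -leqNgt.
Qed.

Section SchubertConditions.
Variables (K : fieldType) (d n : nat).
Implicit Types (A : 'M[K]_(n, d)) (x : Idn d n).

Lemma Idn_leq x (s t : 'I_d) : (s <= t)%N -> (tnth x s <= tnth x t)%N.
Proof. by rewrite leq_eqVlt => /orP [/eqP/val_inj -> //|/(Idn_ltn x)/ltnW]. Qed.

Lemma span_coord0 (X : seq 'cV[K]_n) j (u : 'cV[K]_n) :
  {in X, forall z : 'cV[K]_n, z j 0 = 0} -> u \in <<X>>%VS -> u j 0 = 0.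
Proof.
pose f := linfun (mulmx (delta_mx 0 j : 'rV[K]_n) : 'cV[K]_n -> 'cV[K]_1).
have fE z : (z \in lker f) = (z j 0 == 0).
  rewrite memv_ker lfunE /= -rowE; apply/eqP/eqP => [/rowP /(_ 0)|zj].
    by rewrite !mxE.
  by apply/rowP => i; rewrite !mxE ord1.
move=> X0 uX; apply/eqP; rewrite -fE; apply: subvP uX.
by apply/span_subvP => z /X0/eqP; rewrite fE.
Qed.

Lemma mem_span_basis_vec k (P : pred 'I_k) (u : 'cV[K]_k) :
  (forall j, ~~ P j -> u j 0 = 0) ->
  u \in <<[seq basis_vec K j | j : 'I_k <- enum 'I_k & P j]>>%VS.
Proof.
move=> u0; have -> : u = \sum_j u j 0 *: basis_vec K j.
  apply/colP => i; rewrite summxE (bigD1 i) //= big1 => [|j ji].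
    by rewrite !mxE !eqxx addr0 mulr1.
  by rewrite !mxE eq_sym (negPf ji) mulr0.
apply: memv_suml => j _; have [Pj|/u0 ->] := boolP (P j); last first.
  by rewrite scale0r mem0v.
apply/memvZ/memv_span/map_f; by rewrite mem_filter Pj mem_enum.
Qed.

Lemma mem_colspan A u : u \in colspan A -> exists y, u = A *m y.
Proof.
pose f := linfun (mulmx A : 'cV[K]_d -> 'cV[K]_n).
have sAf : (colspan A <= limg f)%VS.
  apply/span_subvP => _ /mapP [j _ ->]; apply/memv_imgP.
  by exists (delta_mx j 0); rewrite ?memvf // lfunE /= colE.
by move=> /(subvP sAf)/memv_imgP [y _ ->]; exists y; rewrite lfunE.
Qed.

Lemma plucker_inj A x (y : 'cV[K]_d) :
  plucker A x != 0 -> rowsub (tnth x) (A *m y) = 0 -> y = 0.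
Proof.
rewrite -unitfE -[_ \in _]/(_ \in unitmx) => uA.
by rewrite -mul_rowsub_mx => /(congr1 (mulmx (invmx (rowsub (tnth x) A))));
   rewrite mulKmx // mulmx0.
Qed.

(** As p_x(A) is nonzero, reading the coordinates x_t is injective on the column span; on [W] only
    those with [t] in [T] survive. *)
Lemma dim_colspan_coord0 A x (W : {vspace 'cV[K]_n}) (T : pred 'I_d) :
  plucker A x != 0 -> (W <= colspan A)%VS ->
  (forall u t, u \in W -> ~~ T t -> u (tnth x t) 0 = 0) -> (\dim W <= #|T|)%N.
Proof.
move=> Ax WA W0.
pose f := linfun (mulmx (rowsub (tnth x) 1%:M) : 'cV[K]_n -> 'cV[K]_d).
have fE u : f u = rowsub (tnth x) u by rewrite lfunE /= -rowsubE.
rewrite -(@limg_dim_eq _ _ _ f); last first.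
  apply/eqP; rewrite -subv0; apply/subvP => u /memv_capP [/(subvP WA)].
  move=> /mem_colspan [y ->]; rewrite memv_ker fE memv0 => /eqP/(plucker_inj Ax) ->.
  by rewrite mulmx0.
pose X := [seq basis_vec K t | t : 'I_d <- enum 'I_d & T t].
apply: leq_trans (_ : (size X <= _)%N); last first.
  rewrite size_map cardE.
  apply: uniq_leq_size => [|t]; first exact/filter_uniq/enum_uniq.
  by rewrite mem_filter !mem_enum => /andP [].
apply: leq_trans (dim_span X); apply/dimvS/subvP => _ /memv_imgP [u uW ->].
by apply: mem_span_basis_vec => t nTt; rewrite fE mxE; apply: W0.
Qed.

(** If w_t < x_t, vectors supported on rows up to w_t vanish at x_s for all s >= t. This leaves
    dimension at most [t], one short of the Schubert condition. *)
Lemma Schubert_plucker A w x :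
  Schubert w (colspan A) -> plucker A x != 0 -> Ige w x.
Proof.
move=> [_ wA] Ax; apply/forallP => t; rewrite leqNgt; apply/negP => wx.
have td := ltn_ord t; have := wA t; apply/negP; rewrite -ltnNge ltnS.
rewrite -[leqRHS](card_ord_ltn (ltnW td)).
apply: (dim_colspan_coord0 Ax (capvSl _ _)) => u s /memv_capP [_ uV].
rewrite inE -leqNgt => ts; apply: span_coord0 uV => _ /mapP [j + ->].
rewrite mem_filter ltnS => /andP [jw _]; rewrite mxE andbT.
case: eqP => // xs; move: (leq_trans wx (Idn_leq x ts)).
by rewrite xs ltnNge jw.
Qed.

(** If x_t < v_t, vectors supported on rows from v_t on vanish at x_s for all s <= t. This leaves
    dimension at most [d - t.+1], while the condition at [rev_ord t] asks for one more. *)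
Lemma opp_Schubert_plucker A v x :
  opp_Schubert v (colspan A) -> plucker A x != 0 -> Ige x v.
Proof.
move=> [_ vA] Ax; apply/forallP => t; rewrite leqNgt; apply/negP => xv.
have td := ltn_ord t; have := vA (rev_ord t); apply/negP.
rewrite -ltnNge ltnS rev_ordK -[leqRHS]/(d - t.+1)%N -[leqRHS]card_ord_geq //.
apply: (dim_colspan_coord0 Ax (capvSl _ _)) => u s /memv_capP [_ uV].
rewrite inE -ltnNge ltnS => st; apply: span_coord0 uV => _ /mapP [j + ->].
rewrite mem_filter => /andP [jv _]; rewrite mxE andbT.
case: eqP => // xs; have := Idn_leq x st; rewrite xs; move: jv xv.
have := ltn_ord (tnth v t); lia.
Qed.

Lemma dim_span_cols A x (P : pred 'I_d) : plucker A x != 0 ->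
  \dim <<[seq col j A | j : 'I_d <- enum 'I_d & P j]>> = #|P|.
Proof.
move=> Ax; have := enum_uniq 'I_d; move/(filter_uniq P).
set s := filter P _ => s_uniq.
suff : free [seq col j A | j <- s].
  move/eqP => ->; rewrite size_map; apply/eqP; rewrite cardE.
  rewrite -uniq_size_uniq ?enum_uniq // => t.
  by rewrite mem_enum mem_filter mem_enum andbT.
apply/(@freeP _ _ _ (map_tuple (fun j => col j A) (in_tuple s))) => k k0 i.
have ks : \sum_(i < size s) k i *: basis_vec K (tnth (in_tuple s) i) = 0.
  apply: (plucker_inj Ax); rewrite (_ : A *m _ = 0) ?linear0 //.
  rewrite -[RHS]k0 linear_sum /=; apply: eq_bigr => j _.
  rewrite -scalemxAr -colE /= (nth_map (tnth (in_tuple s) j)) //.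
  by congr (_ *: col _ _); apply: tnth_nth.
have /colP /(_ (tnth (in_tuple s) i)) := ks; rewrite summxE mxE (bigD1 i) //=.
rewrite big1 => [|j ji]; rewrite !mxE.
  by rewrite eqxx mulr1 addr0.
have s_inj := elimT (tuple_uniqP (in_tuple s)) s_uniq.
by rewrite andbT (inj_eq s_inj) eq_sym (negPf ji) mulr0.
Qed.

(** A nonzero minor makes the columns independent. As [w] and [v] increase, the first t+1 columns
    are supported on rows up to w_t, and the last t+1 on rows from the entry of [v] at [rev_ord t]
    on. *)
Lemma staircase_Richardson A (w v : Idn d n) x :
  (forall j t, A j t != 0 -> (tnth v t <= j <= tnth w t)%N) ->
  plucker A x != 0 -> Richardson w v (colspan A).
Proof.
move=> A0 Ax; have grA : Grassmannian d (colspan A).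
  rewrite /Grassmannian -[RHS](card_ord d) -(dim_span_cols _ Ax).
  by rewrite /colspan; congr (\dim <<map _ _>>); rewrite filter_predT.
split; split=> // t; have td := ltn_ord t.
  rewrite -[leqLHS](card_ord_ltn td) -(dim_span_cols _ Ax); apply/dimvS.
  rewrite subv_cap; apply/andP; split; apply/span_subvP => _ /mapP [j + ->].
    by move=> _; apply/memv_span/map_f; rewrite mem_enum.
  rewrite mem_filter /= ltnS => /andP [jt _]; apply: mem_span_basis_vec => i.
  rewrite -leqNgt mxE => wi; apply/eqP; apply: contraLR wi => /A0 /andP [_ iw].
  by rewrite -leqNgt (leq_trans iw) // Idn_leq.
have -> : t.+1 = #|[pred i : 'I_d | (rev_ord t <= i)%N]|.
  by rewrite card_ord_geq ?leq_subr //= subKn.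
rewrite -(dim_span_cols _ Ax); apply/dimvS.
rewrite subv_cap; apply/andP; split; apply/span_subvP => _ /mapP [j + ->].
  by move=> _; apply/memv_span/map_f; rewrite mem_enum.
rewrite mem_filter => /andP [/(Idn_leq v) jt _]; apply: mem_span_basis_vec => i.
rewrite -ltnNge mxE => iv; apply/eqP; apply: contraLR iv => /A0 /andP [vi _].
move: jt vi; have := ltn_ord (tnth v (rev_ord t)); lia.
Qed.

End SchubertConditions.

(** * Linear independence *)

(** Among the terms with nonzero coefficient, the one of largest size is alone in reaching its
    degree, so its leading term cannot cancel. *)
Lemma monic_sizes_free (R : nzRingType) (I : finType) (p : I -> {poly R})
    (c : I -> R) :
  (forall i, p i \is monic) -> injective (fun i => size (p i)) ->
  \sum_i c i *: p i = 0 -> forall i, c i = 0.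
Proof.
move=> p_monic size_inj sum0 i0; apply/eqP; apply: contraT => ci0.
case: (@arg_maxnP I i0 (fun i => c i != 0) (fun i => size (p i)) ci0) => i ci max_i.
move/(congr1 (fun q : {poly R} => q`_(size (p i)).-1)): sum0.
rewrite coef0 coef_sum (bigD1 i) //= coefZ -/(lead_coef (p i)) (monicP (p_monic i)).
rewrite mulr1 big1 ?addr0 => [ci_0|j ji]; first by rewrite ci_0 eqxx in ci.
rewrite coefZ; have [->|/max_i le_ji] := eqVneq (c j) 0; first by rewrite mul0r.
rewrite nth_default ?mulr0 // -ltnS prednK ?size_poly_gt0 ?monic_neq0 //.
by rewrite ltn_neqAle (inj_eq size_inj) ji; apply: le_ji.
Qed.

Lemma digits_inj B N (c c' : nat -> nat) :
  (forall e, c e < B)%N -> (forall e, c' e < B)%N ->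
  (\sum_(e < N) c e * B ^ e = \sum_(e < N) c' e * B ^ e)%N ->
  forall e, (e < N)%N -> c e = c' e.
Proof.
elim: N c c' => [//|N IH] c c' cB c'B.
have shift (a : nat -> nat) : (\sum_(e < N.+1) a e * B ^ e =
    (\sum_(e < N) a e.+1 * B ^ e) * B + a 0)%N.
  rewrite big_ord_recl muln1 addnC big_distrl /=; congr (_ + _)%N.
  by apply: eq_bigr => e _; rewrite /bump /= add1n expnS -mulnA (mulnC B).
rewrite !shift => eq_s.
have c0 : c 0%N = c' 0%N.
  by move/(congr1 (modn^~ B)): eq_s; rewrite !modnMDl !modn_small.
have B0 : (0 < B)%N by apply: leq_ltn_trans (cB 0%N).
move/eqP: eq_s; rewrite c0 eqn_add2r eqn_pmul2r // => /eqP eq_s [|e] //.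
exact: (IH (fun e => c e.+1) (fun e => c' e.+1)).
Qed.

(** Let [i] be the least moved point. All smaller points are fixed, so both [s i] and the preimage
    of [i] exceed [i]. *)
Lemma perm_inversion d (s : 'S_d) : s != 1%g ->
  exists i j : 'I_d, (i < j)%N /\ (s j < s i)%N.
Proof.
move=> s1; have [i0 si0] : exists i, s i != i.
  apply/existsP; apply: contraR s1; rewrite negb_exists => /forallP s_id.
  by apply/eqP/permP => i; rewrite perm1; apply/eqP; rewrite -[_ == _]negbK.
case: (@arg_minnP _ i0 (fun i => s i != i) val si0) => i si min_i.
have fix_lt (j : 'I_d) : (j < i)%N -> s j = j.
  by move=> ji; apply/eqP; apply: contraLR ji => /min_i; rewrite -leqNgt.
exists i, (s^-1%g i); rewrite permKV; split; rewrite ltn_neqAle.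
  rewrite val_eqE; apply/andP; split.
    by apply: contraNneq si => {1}->; rewrite permKV.
  rewrite leqNgt; apply/negP => /[dup] lt /fix_lt; rewrite permKV => ii.
  by rewrite -ii ltnn in lt.
rewrite val_eqE eq_sym si leqNgt; apply/negP => /[dup] lt /fix_lt/perm_inj ii.
by rewrite ii ltnn in lt.
Qed.

(** Undoing an inversion strictly raises the sum, so a maximising permutation has no inversion and
    is the identity. *)
Lemma rearrangement d n (W : nat -> nat -> nat) (x : Idn d n) (s : 'S_d) :
  (forall j j' a a', j < j' -> a < a' -> a' < d ->
     W j a' + W j' a < W j a + W j' a')%N ->
  s != 1%g -> (\sum_t W (tnth x t) (s t) < \sum_t W (tnth x t) t)%N.
Proof.
move=> superW s1; pose S (s : 'S_d) := (\sum_t W (tnth x t) (s t))%N.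
have improve s' : s' != 1%g -> exists s'', (S s' < S s'')%N.
  move=> /perm_inversion [i [j [ij sji]]]; exists (tperm i j * s')%g.
  have ji : j != i by rewrite -val_eqE eq_sym /= (ltn_eqF ij).
  have splitS F : (\sum_t F t = F i + F j + \sum_(t | (t != i) && (t != j)) F t)%N.
    by rewrite (bigD1 i) //= (bigD1 j) //= addnA.
  rewrite /S !splitS !permM tpermL tpermR.
  rewrite [in ltnRHS](eq_bigr (fun t => W (tnth x t) (s' t))) => [|t /andP [ti tj]].
    rewrite ltn_add2r addnC addnC; apply: superW => //; exact: Idn_ltn.
  by rewrite permM tpermD // eq_sym.
case: (@arg_maxnP _ 1%g xpredT S isT) => s0 _ max_s0.
have s0_1 : s0 = 1%g.
  apply/eqP; apply: contraT => /improve [s' lt].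
  by have := leq_trans lt (max_s0 s' isT); rewrite ltnn.
(* One strict improvement of [s] before using maximality makes the comparison with the identity
   strict. *)
have [s' lt] := improve _ s1; apply: leq_trans lt _.
apply: leq_trans (max_s0 s' isT) _.
by rewrite s0_1; apply/eq_leq/eq_bigr => t _; rewrite perm1.
Qed.

Section Independence.
Variables (K : fieldType) (d n m : nat) (w v : Idn d n).

(* The bound m < B makes base-B digits count entries of at most m index tuples;
   B >= 2 makes W supermodular, so that the diagonal term of a minor wins. *)
Let B := m.+2.
Let W (j t : nat) : nat := (B ^ (j * d + t))%N.

(** With e = j' * d + a', both terms on the left are at most B^(e-1), so their sum is at most B^e =
    [W j' a']; positivity of [W j a] makes it strict. *)
Let W_super j j' a a' : (j < j')%N -> (a < a')%N -> (a' < d)%N ->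
  (W j a' + W j' a < W j a + W j' a')%N.
Proof.
move=> jj aa ad; have jd : (j * d + d <= j' * d)%N.
  by rewrite -mulSnr leq_mul2r jj orbT.
have e1 : (W j a' <= B ^ (j' * d + a').-1)%N by apply: leq_pexp2l => //; lia.
have e2 : (W j' a <= B ^ (j' * d + a').-1)%N by apply: leq_pexp2l => //; lia.
have e3 : W j' a' = (B * B ^ (j' * d + a').-1)%N.
  by rewrite -expnS prednK // addn_gt0 (leq_ltn_trans _ aa) ?orbT.
have Wpos : (0 < W j a)%N by rewrite expn_gt0.
rewrite e3 /B !mulSn; move: Wpos e1 e2.
move: (W j a) (W j a') (W j' a) (B ^ _)%N => p q r u; lia.
Qed.

Definition staircase_mx : 'M[{poly K}]_(n, d) :=
  \matrix_(j, t) if (tnth v t <= j <= tnth w t)%N then 'X^(W j t) else 0.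

Definition diag_weight (x : Idn d n) : nat := (\sum_(t < d) W (tnth x t) t)%N.

Definition staircase_minor (x : Idn d n) : {poly K} :=
  \det (rowsub (tnth x) staircase_mx).

(** The bounds put every diagonal entry inside the staircase. Any other permutation gives zero or,
    up to sign, a monomial of smaller degree by [rearrangement]. *)
Lemma staircase_minor_lead x : Ige w x -> Ige x v ->
  staircase_minor x \is monic /\ size (staircase_minor x) = (diag_weight x).+1.
Proof.
move=> /forallP wx /forallP xv; rewrite /staircase_minor /determinant.
rewrite (bigD1 1%g) //= odd_perm1 mul1r.
have -> : \prod_i rowsub (tnth x) staircase_mx i ((1%g : 'S_d) i) =
    'X^(diag_weight x).
  rewrite /diag_weight -prodrXr; apply: eq_bigr => t _.
  by rewrite perm1 !mxE wx xv.
set r := (X in _ + X).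
have r_small : (size r < size ('X^(diag_weight x) : {poly K}))%N.
  rewrite size_polyXn ltnS; apply: (leq_trans (size_sum _ _ _)).
  apply/bigmax_leqP => s s1.
  have [z|nz] := eqVneq (\prod_i rowsub (tnth x) staircase_mx i (s i)) 0.
    by rewrite z mulr0 size_poly0.
  have -> : \prod_i rowsub (tnth x) staircase_mx i (s i) =
      'X^(\sum_t W (tnth x t) (s t)).
    rewrite -prodrXr; apply: eq_bigr => t _.
    move/prodf_neq0: nz => /(_ t isT); rewrite !mxE.
    by case: ifP => // _; rewrite eqxx.
  rewrite mulr_sign [size _](_ : _ = (\sum_t W (tnth x t) (s t)).+1).
    exact: rearrangement.
  by case: ifP; rewrite ?size_polyN size_polyXn.
split; last by rewrite size_polyDl // size_polyXn.
by rewrite monicE lead_coefDl // lead_coefXn.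
Qed.

Let digit (s : seq (Idn d n)) (e : nat) : nat :=
  (\sum_(x <- s) \sum_(t < d) (tnth x t * d + t == e))%N.

(** Each [x] contributes at most once, since [e] modulo [d] determines the place [t]. *)
Let digit_leq s e : (digit s e <= size s)%N.
Proof.
rewrite -sum1_size; apply: leq_sum => x _.
have [t0 /eqP et0|no_t] := pickP (fun t : 'I_d => tnth x t * d + t == e)%N;
  last first.
  by rewrite big1 // => t _; rewrite no_t.
rewrite (bigD1 t0) //= et0 eqxx big1 // => t tt0.
apply/eqP; rewrite eqb0; apply: contra tt0 => /eqP; rewrite -et0.
move/(congr1 (modn^~ d)); rewrite !modnMDl !modn_small // => tt0.
exact/eqP/val_inj.
Qed.

Let total_digits s :
  (\sum_(x <- s) diag_weight x = \sum_(e < n * d) digit s e * B ^ e)%N.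
Proof.
under [RHS]eq_bigr => e _ do rewrite /digit big_distrl /=.
rewrite [RHS]exchange_big; apply: eq_bigr => x _ /=.
under [RHS]eq_bigr => e _ do rewrite big_distrl /=.
rewrite [RHS]exchange_big; apply: eq_bigr => t _ /=.
have lt_e : (tnth x t * d + t < n * d)%N.
  have := ltn_ord (tnth x t); have := ltn_ord t => td xn.
  have : ((tnth x t).+1 * d <= n * d)%N by rewrite leq_mul2r xn orbT.
  by rewrite mulSn; lia.
rewrite (bigD1 (Ordinal lt_e)) //= eqxx mul1n big1 ?addn0 // => e ne.
by rewrite eq_sym [_ == _](negPf ne).
Qed.

Let digitE s (j : 'I_n) (t : 'I_d) :
  digit s (j * d + t) = count_mem j [seq tnth x t | x : Idn d n <- s].
Proof.
rewrite -sum1_count big_map [RHS]big_mkcond; apply: eq_bigr => x _.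
rewrite (bigD1 t) //= eqn_add2r eqn_pmul2r ?(leq_ltn_trans _ (ltn_ord t)) //.
rewrite big1 ?addn0 => [|t' tt']; first by rewrite val_eqE; case: eqP.
apply/eqP; rewrite eqb0; apply: contra tt' => /eqP /(congr1 (modn^~ d)).
by rewrite !modnMDl !modn_small // => tt'; apply/eqP/val_inj.
Qed.

(** The base-[B] digits of the total tell how often each [j] stands in place [t] of the members of
    [s]. Standardness makes the entries in place [t] weakly decreasing along [s], so these
    multiplicities recover them in order. *)
Lemma total_diag_weight_inj (s s' : m.-tuple (Idn d n)) :
  standard s -> standard s' ->
  (\sum_(x <- s) diag_weight x = \sum_(x <- s') diag_weight x)%N -> s = s'.
Proof.
move=> st st'; rewrite !total_digits => eq_s.
have dB (r : m.-tuple (Idn d n)) e : (digit r e < B)%N.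
  by apply: leq_ltn_trans (digit_leq r e) _; rewrite size_tuple.
have eq_digit := digits_inj (dB s) (dB s') eq_s.
have eq_rows t : [seq tnth x t | x : Idn d n <- s] =
    [seq tnth x t | x : Idn d n <- s'].
  pose r := fun a b : 'I_n => (b <= a)%N.
  have sorted_row (u : m.-tuple (Idn d n)) :
      standard u -> sorted r [seq tnth x t | x : Idn d n <- u].
    rewrite /standard sorted_map; apply: sub_sorted => x y /forallP; exact.
  apply: (@sorted_eq _ r) (sorted_row _ st) (sorted_row _ st') _.
  - by move=> a b c ab bc; apply: leq_trans bc ab.
  - by move=> a b; rewrite andbC => /anti_leq/val_inj.
  apply/allP => j _ /=; rewrite -!digitE; apply/eqP/eq_digit.
  have := ltn_ord j; have := ltn_ord t => td jn.
  have : (j.+1 * d <= n * d)%N by rewrite leq_mul2r jn orbT.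
  by rewrite mulSn; lia.
apply: eq_from_tnth => i; apply/val_inj/eq_from_tnth => t.
have x0 := tnth s i; have := congr1 (fun r => nth (tnth x0 t) r i) (eq_rows t).
by rewrite !(nth_map x0) ?size_tuple // -!tnth_nth.
Qed.

Lemma standard_on_bounds (s : m.-tuple (Idn d n)) x :
  standard_on w v s -> x \in tval s -> Ige w x /\ Ige x v.
Proof.
have Ige_trans : transitive (@Ige d n).
  move=> b a c /forallP ab /forallP bc; apply/forallP => t.
  exact: leq_trans (bc t) (ab t).
have Ige_refl : reflexive (@Ige d n) by move=> a; apply/forallP.
move=> /and3P []; rewrite /standard; case: (tval s) => //= y r.
move=> r_path wy lv x_in; split.
  move: x_in; rewrite inE => /orP [/eqP -> //|xr].
  by by apply: (Ige_trans _ _ _ wy); apply/(allP (order_path_min Ige_trans r_path)).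
apply: (Ige_trans _ _ _ _ lv); case/splitPl: x_in r_path => r1 r2 <-.
rewrite cat_path last_cat => /andP [_].
move: (last y r1) => z; elim: r2 z => [|a r2 IH] z //= /andP [za ar2].
exact: (Ige_trans _ _ _ za (IH _ ar2)).
Qed.

End Independence.

(** Specialising the variable of the staircase matrix to any [a] in [K] gives a matrix covered by
    the assumption, so the combination of products of staircase minors vanishes at every [a]. It is
    then the zero polynomial, and its monic terms have pairwise different degrees. *)
Lemma standard_monomials_free (K : closedFieldType) (d n m : nat) (w v : Idn d n)
    (c : {t : m.-tuple (Idn d n) | standard_on w v t} -> K) :
  (forall A : 'M[K]_(n, d),
     (forall x, plucker A x = 0) \/ Richardson w v (colspan A) ->
     \sum_t c t * \prod_(x <- val t) plucker A x = 0) ->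
  forall t, c t = 0.
Proof.
move=> c0; pose p (t : {t : m.-tuple (Idn d n) | standard_on w v t}) :=
  \prod_(x <- val t) staircase_minor K m w v x.
have minorP (t : {t : m.-tuple (Idn d n) | standard_on w v t}) x :
    x \in tval (val t) ->
    staircase_minor K m w v x \is monic /\
    size (staircase_minor K m w v x) = (diag_weight m x).+1.
  by move=> /(standard_on_bounds (valP t)) [wx xv]; apply: staircase_minor_lead.
have p_monic t : p t \is monic.
  by rewrite /p big_seq; apply: monic_prod => x /minorP [].
have size_p t : size (p t) = (\sum_(x <- val t) diag_weight m x).+1.
  rewrite /p; have : {subset tval (val t) <= tval (val t)} by [].
  elim: {1 3 4}(tval (val t)) => [|x s IH] sub.
    by rewrite !big_nil size_poly1.
  have [xm xs] := minorP t x (sub _ (mem_head _ _)).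
  rewrite !big_cons size_monicM ?xs ?IH ?addSn ?addnS //.
    by move=> y ys; apply: sub; rewrite inE ys orbT.
  rewrite -size_poly_eq0 IH // => y ys; apply: sub; by rewrite inE ys orbT.
apply: (monic_sizes_free p_monic) => [s t|].
  rewrite !size_p => -[] /total_diag_weight_inj eq_st; apply/val_inj/eq_st.
    by case/and3P: (valP s).
  by case/and3P: (valP t).
(* A nonzero polynomial over an algebraically closed field has a non-root [a]; the relation at this
   [a] contradicts it. *)
apply/eqP; apply: contraT => /closed_nonrootP [a /negP []].
pose A := map_mx (horner_eval a) (staircase_mx K m w v).
have Ap x : plucker A x = (staircase_minor K m w v x).[a].
  by rewrite /plucker -map_mxsub det_map_mx.
have : \sum_t c t * \prod_(x <- val t) plucker A x = 0.
  (* All minors may vanish at [a], which gives the origin of the cone; otherwise one nonzero minor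
     puts the column span in the Richardson variety. *)
  apply: c0; have [[x Ax]|no_x] := pselect (exists x, plucker A x != 0).
    right; apply: staircase_Richardson Ax => j t; rewrite !mxE.
    by case: ifP => // _; rewrite /horner_eval horner0 eqxx.
  by left=> x; apply/eqP; apply: contraT => Ax; case: no_x; exists x.
move=> sum0; apply/rootP; rewrite -[RHS]sum0 horner_sum.
apply: eq_bigr => t _; rewrite hornerZ horner_prod; congr (_ * _).
by apply: eq_bigr => x _; rewrite Ap.
Qed.

(** * The coordinate ring *)

Section CoordRing.
Variables (K : fieldType) (d n : nat) (X : {vspace 'cV[K]_n} -> Prop).
Local Notation S := (Pring K d n).

Lemma to_coord_ring_eq0 (f : S) :
  to_coord_ring X f = 0 <-> in_vanishing_ideal X f.
Proof.
have -> : (to_coord_ring X f = 0) <-> (f \in vanishing_ideal (d := d) X).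
  rewrite -(rmorph0 (to_coord_ring X)) /to_coord_ring.
  rewrite -[f in _ <-> is_true (f \in _)]subr0.
  by rewrite Quotient.idealrBE; split => [->|/eqP].
by split=> /asboolP.
Qed.

Definition ring_monomial (s : seq (Idn d n)) : S := \prod_(x <- s) pvar K x.

Lemma ring_monomial_homog s : ring_monomial s \is (size s).-homog.
Proof.
elim: s => [|x s IH]; first by rewrite /ring_monomial big_nil dhomog1.
rewrite /ring_monomial big_cons /= -add1n; apply: dhomogM IH.
by rewrite dhomogX /= mdeg1.
Qed.

Lemma peval_ring_monomial (y : Idn d n -> K) s :
  peval y (ring_monomial s) = \prod_(x <- s) y x.
Proof.
rewrite /peval rmorph_prod; apply: eq_bigr => x _.
by rewrite /= mevalXU enum_rankK.
Qed.

Lemma peval_sum_monomials (I : finType) (P : pred I) (c : I -> K)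
    (s : I -> seq (Idn d n)) (y : Idn d n -> K) :
  peval y (\sum_(i | P i) c i *: ring_monomial (s i)) =
  \sum_(i | P i) c i * \prod_(x <- s i) y x.
Proof.
rewrite /peval rmorph_sum; apply: eq_bigr => i _.
by rewrite /= mevalZ -peval_ring_monomial.
Qed.

Lemma to_coord_ring_monomial s :
  to_coord_ring X (ring_monomial s) = \prod_(x <- s) to_coord_ring X (pvar K x).
Proof. exact: rmorph_prod. Qed.

(** Each monomial of degree [m] is a product of [m] Pluecker coordinates and is straightened
    separately. *)
Lemma std_span_homog m (f : S) : f \is m.-homog ->
  std_span m (fun A => peval (plucker A) f).
Proof.
move=> /dhomogP f_homog; pose N := #|{: Idn d n}|.
pose mon i : 'X_{1..N} := nth 0%MM (msupp f) i.
have mon_deg (i : 'I_(size (msupp f))) : mdeg (mon i) = m.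
  by apply: f_homog; rewrite mem_nth.
(* The exponent vector unfolds into the list of its indices with multiplicity. *)
pose s i : seq (Idn d n) :=
  flatten [seq nseq (mon i k) (enum_val k) | k <- enum 'I_N].
have size_s (i : 'I_(size (msupp f))) : size (s i) = m.
  rewrite -(mon_deg i) mdegE size_flatten sumnE /shape 2!big_map big_enum.
  by apply: eq_bigr => k _; rewrite size_nseq.
have [e eP] := @std_span_sum K d n m _ (fun i : 'I_(size (msupp f)) => f@_(mon i))
  (fun i A => \prod_(x <- s i) plucker A x) (fun i _ => straightening K (size_s i)).
exists e => A; rewrite -eP /peval mevalE (big_nth 0%MM) big_mkord.
apply: eq_bigr => i _; congr (_ * _).
rewrite big_flatten big_map big_enum; apply: eq_bigr => k _ /=.
by rewrite big_nseq iter_mulr_1.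
Qed.
End CoordRing.

(** For d > 0 the origin is the vector of minors of the zero matrix, so every point of the cone
    comes from a matrix. *)
Lemma affine_cone_plucker (K : fieldType) (d n : nat)
    (X : {vspace 'cV[K]_n} -> Prop)
    (y : Idn d n -> K) : (0 < d)%N -> affine_cone X y ->
  exists2 A : 'M[K]_(n, d), y =1 plucker A &
    (forall x, plucker A x = 0) \/ X (colspan A).
Proof.
move=> d_gt0 [y0|[A XA yA]]; last by exists A; [exact: yA | right].
have A0 x : plucker (0 : 'M[K]_(n, d)) x = 0.
  have -> : plucker (0 : 'M[K]_(n, d)) x = \det (0 : 'M[K]_d).
    by congr (\det _); apply/matrixP => i j; rewrite !mxE.
  by rewrite (_ : 0 = 0%:M) ?det_scalar ?expr0n ?(gtn_eqF d_gt0) // raddf0.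
by exists 0; [move=> x; rewrite A0 | left].
Qed.

Lemma homog_vanishing_plucker (K : fieldType) (d n m : nat)
    (X : {vspace 'cV[K]_n} -> Prop) (f : Pring K d n) :
  (0 < d)%N -> f \is m.-homog ->
  (forall A, (forall x, plucker A x = 0) \/ X (colspan A) ->
     peval (plucker A) f = 0) ->
  to_coord_ring X f = 0.
Proof.
move=> d_gt0 f_homog f0; apply/to_coord_ring_eq0.
exists [:: (1, f)]; last by rewrite big_seq1 mul1r.
move=> gh; rewrite inE => /eqP -> /=; split; first exact: homogE f_homog.
move=> y /(affine_cone_plucker d_gt0) [A yA XA]; rewrite -[RHS](f0 A XA).
by apply: meval_eq => k; rewrite yA.
Qed.

Lemma vanishing_ideal_plucker (K : fieldType) (d n : nat)
    (X : {vspace 'cV[K]_n} -> Prop) (f : Pring K d n) A :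
  to_coord_ring X f = 0 -> (forall x, plucker A x = 0) \/ X (colspan A) ->
  peval (plucker A) f = 0.
Proof.
move=> /to_coord_ring_eq0 [s sP ->] XA; rewrite /peval rmorph_sum big_seq big1 //.
move=> gh /sP [_ gh0]; rewrite rmorphM /= [X in _ * X]gh0 ?mulr0 //.
by case: XA => [A0|XA]; [left | right; exists A].
Qed.

(** A nonzero product has nonzero factors, and the Schubert and opposite Schubert conditions place
    each of them between [v] and [w]. *)
Lemma plucker_standard_on (K : fieldType) (d n m : nat) (w v : Idn d n)
    (t : m.-tuple (Idn d n)) (A : 'M[K]_(n, d)) :
  standard t ->
  (forall x, plucker A x = 0) \/ Richardson w v (colspan A) ->
  \prod_(x <- t) plucker A x != 0 -> standard_on w v t.
Proof.
move=> st XA nz; have bounds x : x \in tval t -> Ige w x /\ Ige x v.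
  move=> xt; have Ax : plucker A x != 0.
    by move: nz; rewrite prodf_seq_neq0 => /allP /(_ x xt).
  case: XA => [A0|[wA vA]]; first by rewrite A0 eqxx in Ax.
  by split; [apply: Schubert_plucker wA Ax | apply: opp_Schubert_plucker vA Ax].
(* For the empty tuple [head] and [last] return the defaults [w] and [v]. *)
rewrite /standard_on st /=; case: (tval t) bounds => [|x s] bounds /=.
  by apply/andP; split; apply/forallP.
by rewrite (bounds x _).1 ?mem_head // (bounds (last x s) _).2 ?mem_last.
Qed.

Theorem theorem3p3p2 (K : closedFieldType) (d n : nat) (hd : (1 <= d < n)%N)
    (w v : Idn d n) (hwv : Ige w v) (m : nat) :
  is_basis (@coord_ring_deg K d n (Richardson (K := K) w v) m)
    (fun t : {t : m.-tuple (Idn d n) | standard_on w v t} =>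
       pmonomial (Richardson (K := K) w v) (val t)).
Proof.
have d_gt0 : (0 < d)%N by case/andP: hd.
set X := Richardson w v; have pmonE t :
    pmonomial (K := K) (m := m) X t = to_coord_ring X (ring_monomial K t).
  by rewrite to_coord_ring_monomial.
have homogE_m (t : m.-tuple (Idn d n)) : ring_monomial K t \is m.-homog.
  by have := ring_monomial_homog K t; rewrite size_tuple.
split=> [t|_ [f f_homog ->]|c c0].
- by exists (ring_monomial K (val t)); rewrite ?pmonE.
- have [e eP] := std_span_homog f_homog.
  exists (fun t => e (val t)).
  pose g := \sum_(t : m.-tuple (Idn d n) | standard t) e t *: ring_monomial K t.
  (* Straightening makes [f] and [g] agree at the minors of every matrix, hence on the cone over
     [X]. *)
  have -> : to_coord_ring X f = to_coord_ring X g.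
    apply/eqP; rewrite -subr_eq0 -raddfB; apply/eqP.
    apply: (homog_vanishing_plucker (m := m)) => //.
      apply: rpredB => //; apply: rpred_sum => t _; exact/dhomogZ/homogE_m.
    move=> A _; rewrite /peval mevalB; apply/eqP; rewrite subr_eq0; apply/eqP.
    by rewrite -/(peval _ f) -/(peval _ g) peval_sum_monomials eP.
  (* Standard monomials that are not standard on [X] are zero in the ring and drop out of [g]. *)
  rewrite raddf_sum /= (bigID (@standard_on d n w v m)) /= [X in _ + X]big1 ?addr0.
    rewrite (eq_bigl (fun t => t \in @standard_on d n w v m)).
      by rewrite big_sub; apply: eq_bigr => t _; rewrite linearZ pmonE.
    by move=> t; rewrite andb_idl // => /and3P [].
  move=> t /andP [st nst]; rewrite linearZ /=.
  rewrite (homog_vanishing_plucker (m := m)) ?scaler0 //.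
  move=> A XA; rewrite peval_ring_monomial; apply/eqP; apply: contraNT nst.
  exact: (plucker_standard_on st XA).
(* The lifted relation lies in the vanishing ideal, so it can be evaluated at the minors of [A]. *)
- apply: standard_monomials_free => A XA.
  have : to_coord_ring X (\sum_t c t *: ring_monomial K (val t)) = 0.
    by rewrite -[RHS]c0 linear_sum; apply: eq_bigr => t _; rewrite linearZ pmonE.
  move=> /vanishing_ideal_plucker /(_ XA) sum0.
  by rewrite -[RHS]sum0 peval_sum_monomials.
Qed.
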